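(* There is a universal constant $K>0$ such that for every list $L$ with induced discrete distribution $F$, \[ \left|\mathrm{OPT}(L)-N(L)\cdot\gamma(F)\right|\le K\cdot N(L)^{2/3}, \] where $\gamma(F)=\lim_{n\to\infty}\mathbb{E}[\mathrm{OPT}(I_n(F))]/n$.
   Context: Bin covering: a list $L=(a_1,\ldots,a_N)$ of item sizes in $[0,1]$, $N(L)=N$; a bin is covered if its total size is at least $1$; $\mathrm{OPT}(L)$ is the maximum number of pairwise disjoint sets of items of $L$ each of total size at least $1$. A discrete distribution $F$ is given by non-negative rational item sizes and positive rational probabilities summing to $1$; $I_n(F)$ is a list of $n$ i.i.d. items drawn from $F$ (the limit defining $\gamma(F)$ exists). The distribution induced by $L$ has as sizes exactly the distinct values occurring in $L$, each value $v$ having probability $|\{j: a_j=v\}|/N$. *)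

(* Defs.v *)
From HB Require Import structures.
From mathcomp Require Import all_boot all_order all_algebra.
From mathcomp Require Import all_classical all_reals all_analysis.

Set Implicit Arguments.
Unset Strict Implicit.
Unset Printing Implicit Defensive.

Import Order.TTheory GRing.Theory Num.Theory.
Import numFieldNormedType.Exports.

Local Open Scope classical_set_scope.
Local Open Scope ring_scope.

(* A bin is a set of positions of L, so that equal sizes occurring at different
   positions are different items.  A covered bin is nonempty, hence counting
   the members of a set of pairwise disjoint bins identifies no two bins. *)
Definition covered (R : realType) (L : seq R) (B : {set 'I_(size L)}) : bool :=
  1 <= \sum_(i in B) L`_i.

Definition OPT (R : realType) (L : seq R) : nat :=
  \max_(P : {set {set 'I_(size L)}} |
        finset.trivIset P && [forall B in P, covered B]) #|P|.

(* The sizes are arbitrary non-negative reals rather than rationals, so that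
   every nonempty list of real sizes induces a discrete distribution. *)
Record discrete_distribution (R : realType) := DiscreteDistribution {
  nsizes : nat ;
  item_size : 'I_nsizes -> R ;
  item_prob : 'I_nsizes -> rat ;
  item_size_inj : injective item_size ;
  item_size_ge0 : forall j, 0 <= item_size j ;
  item_prob_gt0 : forall j, 0 < item_prob j ;
  item_prob_sum1 : \sum_j item_prob j = 1 }.

(* The law of I_n(F), as the product law on the sequences of n size indices. *)
Definition iid_prob (R : realType) (F : discrete_distribution R) (n : nat)
    (t : n.-tuple 'I_(nsizes F)) : R :=
  \prod_(i < n) ratr (item_prob (tnth t i)).

Definition expected_OPT (R : realType) (F : discrete_distribution R) (n : nat)
    : R :=
  \sum_(t : n.-tuple 'I_(nsizes F))
     iid_prob t * (OPT [seq item_size j | j <- t])%:R.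

Definition gamma (R : realType) (F : discrete_distribution R) : R :=
  lim ((fun n : nat => expected_OPT F n / n%:R) @ \oo).

Section Induced.
Context {R : realType} (L : seq R).
Hypotheses (L_neq0 : L != [::]) (L01 : {in L, forall a : R, 0 <= a <= 1}).

Definition induced_size (j : 'I_(size (undup L))) : R := (undup L)`_j.

Definition induced_prob (j : 'I_(size (undup L))) : rat :=
  (count_mem (induced_size j) L)%:R / (size L)%:R.

Lemma induced_size_mem j : induced_size j \in L.
Proof. by rewrite -mem_undup mem_nth. Qed.

Lemma induced_size_inj : injective induced_size.
Proof.
move=> i j /eqP; rewrite nth_uniq ?undup_uniq // => /eqP ij.
exact: val_inj.
Qed.

Lemma induced_size_ge0 j : 0 <= induced_size j.
Proof. by have /andP[] := L01 (induced_size_mem j). Qed.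

Lemma induced_prob_gt0 j : 0 < induced_prob j.
Proof.
rewrite divr_gt0 // ltr0n ?lt0n ?size_eq0 // -lt0n -has_count has_pred1.
exact: induced_size_mem.
Qed.

Lemma induced_prob_sum1 : \sum_j induced_prob j = 1.
Proof.
rewrite -mulr_suml -natr_sum.
have -> : (\sum_j count_mem (induced_size j) L = size L)%N.
  rewrite -(big_mkord xpredT (fun j => count_mem (undup L)`_j L)).
  rewrite -(big_nth 0 xpredT (fun a => count_mem a L)).
  under eq_bigr do rewrite -sum1_count big_mkcond.
  rewrite exchange_big -sum1_size big_seq [RHS]big_seq /=.
  apply: eq_bigr => b bL; rewrite -big_mkcond /= sum1_count.
  rewrite -(eq_count (a1 := pred1 b)); last by move=> a; rewrite /= eq_sym.
  by rewrite count_uniq_mem ?undup_uniq // mem_undup bL.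
by rewrite divff // pnatr_eq0 size_eq0.
Qed.

Definition induced_distribution : discrete_distribution R :=
  DiscreteDistribution induced_size_inj induced_size_ge0 induced_prob_gt0
    induced_prob_sum1.

End Induced.

(* Main.v *)
Require Import Defs.
From mathcomp Require Import all_boot all_order all_algebra.
From mathcomp Require Import all_classical all_reals all_analysis.
From mathcomp Require Import ring lra zify.

(* Compare both quantities with the value of the fractional covering problem on
   the positions of L: maximise the total weight of patterns (multisets of
   positions of total size at least 1) using every position at most once.
   Sampling n items from F is sampling n positions uniformly.  Averaging the
   optimal packings of all samples, scaled by N/n, is a fractional packing;
   conversely a sample contains each position about n/N times (second moment),
   so a fixed fractional packing can be scaled up and rounded down in it, at a
   cost O(sqrt n).  Hence the limit exists and N gamma(F) is the fractional
   optimum, which is at least OPT(L).  In the other direction, sort L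
   decreasingly, cut it into groups of g consecutive items, discard the patterns
   using the first group, and replace the items of each other group by the least
   item of the preceding one.  This costs weight g and leaves N/g + 1 sizes; by
   Caratheodory's theorem N/g + 1 patterns then suffice, so rounding down costs
   N/g + 1 bins.  With g about sqrt N the error is even O(sqrt N). *)

Set Implicit Arguments.
Unset Strict Implicit.
Unset Printing Implicit Defensive.

Import Order.TTheory GRing.Theory Num.Theory.
Import numFieldNormedType.Exports.

Local Open Scope ring_scope.

(** * Integral packings: families of disjoint bins versus lists of patterns *)

Section Packing.
Context {R : realType}.
Implicit Types (T : finType) (L : seq R).

(** [kappa] sorts the items into types, and a pattern is a multiset of types. The number of items of
    a type is the capacity that patterns share. *)
Definition class_card L T (kappa : 'I_(size L) -> T) (k : T) : nat :=
  #|[set i | kappa i == k]|.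

(** Read each bin of an optimal family as the pattern counting its items of each type. Rounding
    sizes up to [s] keeps bins covered, and disjointness gives the capacity bound. *)
Lemma OPT_unpack L T (s : T -> R) (kappa : 'I_(size L) -> T) :
  (forall i : 'I_(size L), L`_i <= s (kappa i)) ->
  exists ps : seq {ffun T -> nat},
    [/\ size ps = OPT L,
        {in ps, forall p : {ffun T -> nat}, 1 <= \sum_k s k *+ p k}
      & forall k, (\sum_(p <- ps) p k <= class_card kappa k)%N].
Proof.
move=> Ls.
pose good := [pred P : {set {set 'I_(size L)}} |
  finset.trivIset P && [forall B in P, covered B]].
(* The empty family is admissible, so the maximum is attained by some [P]. *)
have [|P /andP[tP /forall_inP cP] OPTE] :=
    @eq_bigmax_cond _ good (fun P => #|P|).
  apply/card_gt0P; exists finset.set0; rewrite inE; apply/andP; split.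
    by apply/finset.trivIsetP => A B; rewrite finset.inE.
  by apply/forall_inP => B; rewrite finset.inE.
have {}OPTE : OPT L = #|P| by rewrite -OPTE; exact: eq_bigl.
rewrite OPTE.
pose pat (B : {set 'I_(size L)}) : {ffun T -> nat} :=
  [ffun k => #|B :&: [set i | kappa i == k]|]%SET.
exists [seq pat B | B <- enum P]; split.
- by rewrite size_map -cardE.
- move=> p /mapP[B]; rewrite mem_enum => BP ->.
  apply: le_trans (cP B BP) _.
  apply: le_trans (ler_sum _ (fun i _ => Ls i)) _.
  rewrite (partition_big kappa xpredT) //=.
  apply: ler_sum => k _; rewrite ffunE.
  rewrite (eq_bigr (fun=> s k)); last by move=> i /andP[_ /eqP->].
  rewrite sumr_const le_eqVlt; apply/orP; left; apply/eqP; congr (_ *+ _).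
  by apply: eq_card => i; rewrite !inE.
- move=> k; rewrite big_map big_enum /=.
  rewrite (eq_bigr (fun B : {set 'I_(size L)} =>
    (\sum_(i in B | kappa i == k) 1)%N)); last first.
    move=> B _; rewrite ffunE -sum1_card; apply: eq_bigl => i.
    by rewrite !inE.
  rewrite (exchange_big_dep (fun i => kappa i == k)) //=;
    last by move=> B i _ /andP[].
  rewrite /class_card -sum1_card.
  rewrite [leqRHS](eq_bigl (fun i => kappa i == k)); last by move=> i; rewrite !inE.
  apply: leq_sum => i /eqP ki.
  (* Disjoint bins contain [i] at most once in all, so the inner sum is at most 1. *)
  have [[B BP iB]|nB] := pselect (exists2 B, B \in P & i \in B).
    rewrite (big_pred1 B) // => C /=.
    rewrite ki eqxx andbT; apply/andP/eqP => [[CP iC]|->//].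
    apply/eqP; apply: contraT => CB.
    have := finset.trivIsetP tP _ _ CP BP CB.
    by move=> /pred0P/(_ i); rewrite /= iC iB.
  rewrite big_pred0 // => C; apply/negbTE/negP => /and3P[CP iC _].
  by apply: nB; exists C.
Qed.

Lemma exists_subset_card (U : finType) (A : {set U}) n :
  (n <= #|A|)%N -> exists2 B : {set U}, (B \subset A)%SET & #|B| = n.
Proof.
move=> nA; exists [set x in take n (enum A)]%SET.
  apply/fintype.subsetP => x; rewrite finset.inE => /mem_take.
  by rewrite mem_enum.
rewrite cardsE; move/card_uniqP: (take_uniq n (enum_uniq A)) => ->.
by rewrite size_takel // -cardE.
Qed.

Lemma OPT_pack L T (s : T -> R) (kappa : 'I_(size L) -> T)
    (ps : seq {ffun T -> nat}) :
  (forall i : 'I_(size L), s (kappa i) <= L`_i) ->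
  {in ps, forall p : {ffun T -> nat}, 1 <= \sum_k s k *+ p k} ->
  (forall k, (\sum_(p <- ps) p k <= class_card kappa k)%N) ->
  (size ps <= OPT L)%N.
Proof.
move=> sL ps1 psc.
suff [P [tP cP sP _]] : exists P : {set {set 'I_(size L)}},
    [/\ finset.trivIset P, [forall B in P, covered B], #|P| = size ps
      & (finset.cover P \subset [set: 'I_(size L)])%SET].
  rewrite -sP; apply: (@leq_bigmax_cond _
    (fun P => finset.trivIset P && [forall B in P, covered B])) => //.
  by rewrite tP cP.
(* Capacities are recounted inside a set of free positions, at first all of them, so that the
   induction on [ps] can run over a generic set [D]. *)
have {}psc k : (\sum_(p <- ps) p k <=
    #|[set: 'I_(size L)] :&: [set i | kappa i == k]|)%N%SET.
  by rewrite finset.setTI; exact: psc.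
move: [set: _]%SET psc => D.
elim: ps ps1 D => [_ D _|p ps IH ps1 D psc].
  exists finset.set0; split.
  - by apply/finset.trivIsetP => A B; rewrite finset.inE.
  - by apply/forall_inP => B; rewrite finset.inE.
  - by rewrite cards0.
  - by rewrite /finset.cover big_set0 finset.sub0set.
have pD k : (p k <= #|D :&: [set i | kappa i == k]|)%N%SET.
  by apply: leq_trans (psc k); rewrite big_cons leq_addr.
have [b bD bp] := fin_all_exists2 (fun k => exists_subset_card (pD k)).
pose B := [set i | i \in b (kappa i)]%SET.
have bk k i : i \in b k -> i \in D /\ kappa i = k.
  by move/(fintype.subsetP (bD k)); rewrite !finset.inE => /andP[? /eqP].
have BI k : (B :&: [set i | kappa i == k] = b k)%SET.
  apply/setP => i; rewrite !finset.inE; apply/andP/idP => [[ib /eqP <-//]|ib].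
  by have [_ ->] := bk _ _ ib; rewrite ib.
have BD : (B \subset D)%SET.
  by apply/fintype.subsetP => i; rewrite finset.inE => /bk[].
have covB : covered B.
  apply: le_trans (ps1 p (mem_head _ _)) _.
  apply: (@le_trans _ _ (\sum_(i in B) s (kappa i))); last exact: ler_sum.
  rewrite (partition_big kappa xpredT) //=.
  apply: ler_sum => k _.
  rewrite [leRHS](eq_bigr (fun=> s k)); last by move=> i /andP[_ /eqP->].
  rewrite sumr_const -bp -BI le_eqVlt; apply/orP; left; apply/eqP.
  by congr (_ *+ _); apply: eq_card => i;
    rewrite finset.in_setI; congr (_ && _); rewrite finset.inE.
have [|k|P [tP cP sP PD]] := IH _ (D :\: B)%SET.
- by move=> q qps; apply: ps1; rewrite inE qps orbT.
- have := psc k; rewrite big_cons -(bp k) -BI => h.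
  have -> : ((D :\: B) :&: [set i | kappa i == k] =
     (D :&: [set i | kappa i == k]) :\: (B :&: [set i | kappa i == k]))%SET.
    apply/setP => i; rewrite !finset.inE.
    by case: (kappa i == k); rewrite !(andbT, andbF).
  rewrite cardsD (finset.setIidPr (finset.setSI _ BD)).
  by rewrite leq_subRL //; apply: leq_trans h; rewrite leq_addr.
have BP C : C \in P -> [disjoint B & C].
  move=> CP; rewrite disjoint_sym disjoint_subset; apply/fintype.subsetP => i iC.
  have : i \in finset.cover P by apply/finset.bigcupP; exists C.
  by move=> /(fintype.subsetP PD); rewrite !inE => /andP[].
exists (B |: P)%SET; split.
- apply/finset.trivIsetP => X Y.
  rewrite !finset.inE => /orP[/eqP->|XP] /orP[/eqP->|YP].
  + by rewrite eqxx.
  + by move=> _; exact: BP.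
  + by move=> _; rewrite disjoint_sym; exact: BP.
  + exact: (finset.trivIsetP tP).
- apply/forall_inP => X; rewrite !finset.inE => /orP[/eqP->//|].
  by move: X; apply/forall_inP.
(* If [B] were already in [P], it would be disjoint from itself, hence empty and not covered. *)
- rewrite cardsU1 sP /=; case: (boolP (B \in P)) => //= BinP.
  have := BP _ BinP; rewrite -setI_eq0 finset.setIid => /eqP B0.
  by move: covB; rewrite B0 /covered big_set0 ler10.
- apply/fintype.subsetP => i /finset.bigcupP[X];
  rewrite !finset.inE => /orP[/eqP->|XP iX].
    exact: (fintype.subsetP BD).
  have : i \in finset.cover P by apply/finset.bigcupP; exists X.
  by move=> /(fintype.subsetP PD); rewrite !finset.inE => /andP[].
Qed.

End Packing.

(** * Fractional packings, rounding and sparsification *)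

Section Fractional.
Context {R : realType}.
Implicit Types (T : finType) (L : seq R).

(** A feasible point of the linear relaxation, kept as an explicit list because the length of the
    list measures the loss in rounding. *)
Definition fractional T (s c : T -> R) (l : seq (R * {ffun T -> nat})) :=
  [/\ {in l, forall z : R * {ffun T -> nat}, 0 <= z.1},
      {in l, forall z : R * {ffun T -> nat}, 1 <= \sum_k s k *+ z.2 k}
    & forall k, \sum_(z <- l) z.1 *+ z.2 k <= c k].

Definition weight T (l : seq (R * {ffun T -> nat})) : R := \sum_(z <- l) z.1.

(** Use each pattern as often as the integer part of its coefficient: this loses at most one bin per
    entry of [l]. *)
Lemma weight_le_OPT L T (s : T -> R) (kappa : 'I_(size L) -> T) l :
  (forall i : 'I_(size L), s (kappa i) <= L`_i) ->
  fractional s (fun k => (class_card kappa k)%:R) l ->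
  weight l <= (OPT L)%:R + (size l)%:R.
Proof.
move=> sL [l0 l1 lc].
pose ps := flatten [seq nseq (Num.truncn z.1) z.2 | z <- l].
have : (size ps <= OPT L)%N.
  apply: (@OPT_pack _ _ _ s kappa) => // [p /flattenP[q /mapP[z zl ->]]|k].
    by move=> /nseqP[-> _]; exact: l1.
  rewrite -(ler_nat R); apply: le_trans (lc k).
  rewrite big_flatten big_map natr_sum !big_seq.
  apply: ler_sum => z zl.
  rewrite big_nseq iter_addn_0 mulnC natrM mulr_natr ler_wMn2r //.
  by rewrite truncn_le l0.
rewrite -(ler_nat R) -(lerD2r (size l)%:R); apply: le_trans.
rewrite size_flatten /shape -map_comp sumnE big_map.
rewrite -sum1_size -natrD -big_split natr_sum /weight !big_seq.
apply: ler_sum => z zl; rewrite /= size_nseq addn1.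
by have /andP[_ /ltW] := truncn_itv (l0 _ zl).
Qed.

Lemma OPT_weight L T (s : T -> R) (kappa : 'I_(size L) -> T) :
  (forall i : 'I_(size L), L`_i <= s (kappa i)) ->
  exists2 l, fractional s (fun k => (class_card kappa k)%:R) l &
    weight l = (OPT L)%:R.
Proof.
move=> Ls; have [ps [psz ps1 psc]] := OPT_unpack Ls.
exists [seq (1, p) | p <- ps].
  split=> [z /mapP[p pps ->]//|z /mapP[p pps ->]|k]; first exact: ps1.
  by rewrite big_map -natr_sum ler_nat.
by rewrite /weight big_map -psz -sum1_size natr_sum.
Qed.

Lemma fractional_nil T (s : T -> R) : fractional s (fun=> 0) [::].
Proof. by split=> // k; rewrite big_nil. Qed.

Lemma fractional_cat T (s c1 c2 : T -> R) l1 l2 :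
  fractional s c1 l1 -> fractional s c2 l2 ->
  fractional s (fun k => c1 k + c2 k) (l1 ++ l2).
Proof.
move=> [a1 b1 d1] [a2 b2 d2]; split=> [z|z|k].
- by rewrite mem_cat => /orP[/a1|/a2].
- by rewrite mem_cat => /orP[/b1|/b2].
- by rewrite big_cat lerD.
Qed.

Lemma fractional_scale T (s c : T -> R) a l : 0 <= a ->
  fractional s c l ->
  fractional s (fun k => a * c k) [seq (a * z.1, z.2) | z <- l].
Proof.
move=> a0 [l0 l1 lc]; split=> [z /mapP[y yl ->]|z /mapP[y yl ->]|k].
- by rewrite mulr_ge0 //= l0.
- exact: l1 yl.
- rewrite big_map /=; under eq_bigr do rewrite -mulrnAr.
  by rewrite -mulr_sumr ler_wpM2l.
Qed.

Lemma weight_cat T (l1 l2 : seq (R * {ffun T -> nat})) :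
  weight (l1 ++ l2) = weight l1 + weight l2.
Proof. by rewrite /weight big_cat. Qed.

Lemma weight_scale T a (l : seq (R * {ffun T -> nat})) :
  weight [seq (a * z.1, z.2) | z <- l] = a * weight l.
Proof. by rewrite /weight big_map -mulr_sumr. Qed.

Lemma fractional_le T (s c c' : T -> R) l : (forall k, c k <= c' k) ->
  fractional s c l -> fractional s c' l.
Proof. by move=> cc' [l0 l1 lc]; split=> // k; apply: le_trans (cc' k). Qed.

Lemma weight_ge0 T (s c : T -> R) l : fractional s c l -> 0 <= weight l.
Proof. by move=> [l0 _ _]; rewrite /weight big_seq sumr_ge0. Qed.

Lemma pattern_neq0 T (s : T -> R) (p : {ffun T -> nat}) :
  1 <= \sum_k s k *+ p k -> exists k, (0 < p k)%N.
Proof.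
move=> p1; apply/not_existsP => np; move: p1; rewrite big1 ?ler10 // => k _.
by have := np k; case: (p k) => // n; case.
Qed.

Lemma row_dependency n m (M : 'M[R]_(n, m)) : (m < n)%N ->
  exists2 y : 'I_n -> R, (exists i, y i != 0) &
    forall k, \sum_i y i * M i k = 0.
Proof.
move=> mn; have : kermx M != 0.
  rewrite kermx_eq0 /row_free neq_ltn; apply/orP; left.
  by apply: leq_ltn_trans mn; exact: rank_leq_col.
move=> /matrix0Pn[i [j yij]]; exists (fun j => kermx M i j); first by exists j.
by move=> k; have /matrixP/(_ i k) := mulmx_ker M; rewrite !mxE.
Qed.

(* Move along a linear dependency between the patterns, in the direction that
   does not decrease the weight, until some coefficient vanishes. *)
Lemma sparsify1 T (s c : T -> R) l : (#|T| < size l)%N -> fractional s c l ->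
  exists l', [/\ fractional s c l', (size l' < size l)%N
    & weight l <= weight l'].
Proof.
move=> Tl [l0 l1 lc]; set n := size l in Tl *.
pose z (i : 'I_n) := tnth (in_tuple l) i.
have zl i : z i \in l by exact: mem_tnth.
have [y0 y0N0 y0M] := row_dependency
  (\matrix_(i < n, k < #|T|) ((z i).2 (enum_val k))%:R) Tl.
pose y i := if 0 <= \sum_i y0 i then y0 i else - y0 i.
have ys : 0 <= \sum_i y i.
  by rewrite /y; have [//|h] := leP 0 (\sum_i y0 i); rewrite sumrN oppr_ge0 ltW.
have yN0 : exists i, y i != 0.
  by have [i yi] := y0N0; exists i; rewrite /y; case: ifP; rewrite ?oppr_eq0.
have yM k : \sum_i y i *+ (z i).2 k = 0.
  have : \sum_i y0 i *+ (z i).2 k = 0.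
    rewrite -[RHS](y0M (enum_rank k)); apply: eq_bigr => i _.
    by rewrite mxE enum_rankK mulr_natr.
  rewrite /y; have [//|_ e] := leP 0 (\sum_i y0 i).
  by under eq_bigr do rewrite mulNrn; rewrite sumrN e oppr0.
(* Take [i] with [y i] nonzero and a type [k] used by its pattern: were all entries of [y]
   non-negative, the zero sum [yM k] would force [y i = 0]. *)
have [i1 yi1] : exists i, y i < 0.
  apply/not_existsP => yge0.
  have {}yge0 i : 0 <= y i by rewrite leNgt; apply/negP/yge0.
  have [i yi] := yN0; have [k pk] := pattern_neq0 (l1 _ (zl i)).
  have /psumr_eq0P : \sum_i y i *+ (z i).2 k = 0 by exact: yM.
  move=> /(_ (fun i _ => mulrn_wge0 _ (yge0 i)) i isT)/eqP.
  by rewrite mulrn_eq0 (negbTE yi) orbF -leqn0 leqNgt pk.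
(* Ratio test: [t] is the largest step along [y] keeping all coefficients non-negative, and it
   annihilates the coefficient at [i0]. *)
case: (@Order.TotalTheory.arg_minP _ _ _ i1 (fun i => y i < 0)
  (fun i => (z i).1 / - y i) yi1) => i0 yi0 i0min; pose t := (z i0).1 / - y i0.
have t0 : 0 <= t by rewrite divr_ge0 ?l0 // oppr_ge0 ltW.
pose x i := (z i).1 + t * y i.
have xi0 : x i0 = 0.
  by rewrite /x /t invrN mulrN mulNr divfK ?subrr // lt_eqF.
have x0 i : 0 <= x i.
  have [yi|yi] := leP 0 (y i); first by rewrite addr_ge0 ?l0 // mulr_ge0.
  have := i0min i yi; rewrite -/t ler_pdivlMr ?oppr_gt0 // => h.
  by rewrite /x -[t * y i]opprK -mulrN subr_ge0.
have xsum (F : R -> {ffun T -> nat} -> R) : (forall p, F 0 p = 0) ->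
    \sum_(w <- [seq (x i, (z i).2) | i <- enum 'I_n & i != i0]) F w.1 w.2 =
    \sum_i F (x i) (z i).2.
  move=> F0; rewrite big_map big_filter big_enum_cond /=.
  by rewrite [RHS](bigD1 i0) //= xi0 F0 add0r.
exists [seq (x i, (z i).2) | i <- enum 'I_n & i != i0]; split.
- split=> [w /mapP[i _ ->]|w /mapP[i _ ->]|k]; [exact: x0|exact: l1 (zl i)|].
  rewrite (xsum (fun a p => a *+ p k)); last by move=> p; rewrite mul0rn.
  apply: le_trans (lc k); rewrite [leRHS]big_tnth -/n -/z.
  under eq_bigr do rewrite mulrnDl -mulrnAr.
  by rewrite big_split /= -mulr_sumr yM mulr0 addr0.
- rewrite size_map size_filter -[ltnRHS](size_enum_ord n) ltn_neqAle.
  rewrite count_size andbT -all_count; apply/allPn; exists i0.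
    by rewrite mem_enum.
  by rewrite eqxx.
- rewrite /weight (xsum (fun a p => a)) // [leLHS]big_tnth -/n -/z.
  by rewrite big_split /= lerDl -mulr_sumr mulr_ge0.
Qed.

Lemma sparsify T (s c : T -> R) l : fractional s c l ->
  exists l', [/\ fractional s c l', (size l' <= #|T|)%N
    & weight l <= weight l'].
Proof.
have [n] := ubnP (size l); elim: n l => // n IH l ln fl.
have [lT|Tl] := leqP (size l) #|T|; first by exists l.
have [l1 [fl1 sl1 wl1]] := sparsify1 Tl fl.
have [|l2 [fl2 sl2 wl2]] := IH l1 _ fl1; first exact: leq_trans sl1 _.
by exists l2; split=> //; exact: le_trans wl2.
Qed.

End Fractional.

(** * Linear grouping of the decreasingly sorted items *)

Section Grouping.
Context {R : realType}.
Variables (S : seq R) (g : nat).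
Hypotheses (S_dec : forall i j, (i <= j)%N -> S`_j <= S`_i) (g_gt0 : (0 < g)%N).

Let N := size S.
Let m := (N %/ g).+1.
Let group (i : 'I_N) : 'I_m := inord (i %/ g).
(** The index is the last one of group [q]. For [q = N %/ g] it lies past the end of [S], where
    [nth] returns 0, still a lower bound for the group. *)
Let least (q : 'I_m) : R := S`_(q * g + g.-1).
(** A position of group [q + 1] is charged to type [q], whose size is at least its own; positions of
    group 0 are dropped. *)
Let shift (p : {ffun 'I_N -> nat}) : {ffun 'I_m -> nat} :=
  [ffun q : 'I_m => \sum_(k : 'I_N | k %/ g == q.+1) p k]%N.

Let S_ge0 i : 0 <= S`_i.
Proof.
apply: le_trans (S_dec (leq_addr N i)).
by rewrite nth_default // leq_addl.
Qed.

Let groupE (i : 'I_N) : group i = (i %/ g)%N :> nat.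
Proof. by rewrite inordK // ltnS leq_div2r // ltnW. Qed.

Let least_group (i : 'I_N) : least (group i) <= S`_i.
Proof.
apply: S_dec; rewrite groupE [leqLHS](divn_eq i g) leq_add2l.
by rewrite -ltnS prednK // ltn_mod.
Qed.

Let shift_large (p : {ffun 'I_N -> nat}) :
  (forall k : 'I_N, (k < g)%N -> p k = 0%N) ->
  \sum_(k < N) S`_k *+ p k <= \sum_q least q *+ shift p q.
Proof.
move=> p0; under [leRHS]eq_bigr do rewrite ffunE -sumrMnr.
rewrite (exchange_big_dep xpredT) //=; apply: ler_sum => k _.
have [kg|gk] := ltnP k g.
  by rewrite p0 // mulr0n sumr_ge0 // => q _; rewrite mulr0n.
have kg0 : (0 < k %/ g)%N by rewrite divn_gt0.
have qm : ((k %/ g).-1 < m)%N.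
  by rewrite ltnS (leq_trans (leq_pred _)) // leq_div2r // ltnW.
rewrite (bigD1 (Ordinal qm)) /=; last by rewrite prednK.
rewrite ler_wpDr ?sumr_ge0 // => [q _|]; first by rewrite mulrn_wge0 ?S_ge0.
rewrite ler_wMn2r // S_dec //= (leq_trans _ (leq_divM k g)) //.
by rewrite -[in leqRHS](prednK kg0) mulSn addnC leq_add2r leq_pred.
Qed.

(** Subtracting [g] injects each group into the preceding one. *)
Let next_group_card (q : nat) :
  (#|[set k : 'I_N | k %/ g == q.+1]| <= #|[set k : 'I_N | k %/ g == q]|)%N%SET.
Proof.
have lt_sub (k : 'I_N) : (k - g < N)%N by rewrite (leq_ltn_trans (leq_subr _ _)).
pose f k := Ordinal (lt_sub k).
have gle (k : 'I_N) : (k %/ g == q.+1)%N -> (g <= k)%N.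
  by move=> /eqP kq; rewrite -(divn_gt0 k g_gt0) kq.
rewrite -(@card_in_imset _ _ f) => [|k1 k2]; last first.
  rewrite !finset.inE => /gle g1 /gle g2 /(congr1 val) /= e.
  by apply: val_inj => /=; rewrite -(subnK g1) e subnK.
apply: subset_leq_card; apply/fintype.subsetP => _ /imsetP[k + ->].
rewrite !finset.inE => kq; rewrite -eqSS -(eqP kq) /=.
by rewrite -{2}(subnK (gle _ kq)) divnDr ?dvdnn // divnn g_gt0 addn1.
Qed.

(** The term [g] pays for the patterns meeting the first group, the last term for rounding down the
    patterns that remain after sparsification. *)
Lemma weight_le_OPT_grouping (l : seq (R * {ffun 'I_(size S) -> nat})) :
  fractional (fun i : 'I_(size S) => S`_i) (fun=> 1) l ->
  weight l <= (OPT S + g + (size S %/ g).+1)%:R.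
Proof.
move=> [l0 l1 lc].
(* These patterns avoid the [g] largest items; [shift_large] keeps them covered after [shift]. *)
pose small (z : R * {ffun 'I_N -> nat}) :=
  [forall k : 'I_N, (k < g)%N ==> (z.2 k == 0)%N].
pose l' := [seq (z.1, shift z.2) | z <- l & small z].
have fl' : fractional least (fun q => (class_card group q)%:R) l'.
  split=> [w /mapP[z]|w /mapP[z]|q].
  - by rewrite mem_filter => /andP[_ /l0 z0] ->.
  - rewrite mem_filter => /andP[/forallP zs /l1 z1] ->.
    apply: le_trans z1 _; apply: shift_large => k kg.
    by apply/eqP; have /implyP := zs k; exact.
  - rewrite big_map big_filter /=.
    have : \sum_(z <- l | small z) z.1 *+ shift z.2 q <=
        \sum_(z <- l) \sum_(k : 'I_N | (k %/ g == q.+1)%N) z.1 *+ z.2 k.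
      rewrite big_mkcond big_seq [leRHS]big_seq; apply: ler_sum => z zl /=.
      case: ifP => _; first by rewrite ffunE sumrMnr.
      by rewrite sumr_ge0 // => k _; rewrite mulrn_wge0 // l0.
    move/le_trans; apply; rewrite exchange_big /=.
    apply: le_trans (ler_sum _ (fun k _ => lc k)) _; rewrite sumr_const ler_nat.
    rewrite (_ : #|_| = #|[set k : 'I_N | k %/ g == q.+1]%N%SET|); last first.
      by apply: eq_card => k; rewrite finset.inE.
    apply: leq_trans (next_group_card q) _.
    rewrite /class_card leq_eqVlt; apply/orP; left; apply/eqP.
    by apply: eq_card => k; rewrite !finset.inE -val_eqE /= groupE.
pose modg (k : 'I_N) := Ordinal (ltn_pmod k g_gt0).
(* A discarded pattern uses one of the first [g] positions, and each position carries total weight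
   at most 1. *)
have wl : weight l <= weight l' + g%:R.
  rewrite /weight big_map big_filter /= (bigID small) /= lerD2l.
  apply: (@le_trans _ _
    (\sum_(z <- l) \sum_(k : 'I_N | (k < g)%N) z.1 *+ z.2 k)).
    rewrite big_mkcond big_seq [leRHS]big_seq; apply: ler_sum => z zl /=.
    have zk0 k : 0 <= z.1 *+ z.2 k by rewrite mulrn_wge0 // l0.
    case: ifP => [/forallPn[k]|_]; last by rewrite sumr_ge0.
    rewrite negb_imply => /andP[kg zk].
    rewrite (bigD1 k) //= ler_wpDr ?sumr_ge0 //.
    by rewrite -[leLHS]mulr1n ler_wpMn2l ?l0 // lt0n.
  rewrite exchange_big /=; apply: le_trans (ler_sum _ (fun k _ => lc k)) _.
  rewrite sumr_const ler_nat -(@card_in_imset _ _ modg) => [|k1 k2]; last first.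
    by move=> k1g k2g /(congr1 val) /=; rewrite !modn_small // => /val_inj.
  by rewrite -[leqRHS]card_ord max_card.
have [l2 [fl2 sl2 wl2]] := sparsify fl'.
have := weight_le_OPT least_group fl2; rewrite card_ord in sl2.
rewrite -(ler_nat R) in sl2; rewrite !natrD.
rewrite -/N -/m; lra.
Qed.

End Grouping.

(** * Averages over uniform samples of positions *)

Section Average.
Context {R : realType} {T : finType}.
Hypothesis T_gt0 : (0 < #|T|)%N.
Implicit Types (f : seq T -> R) (s : T -> R).

(** Expectation over [n] independent uniform draws from [T], by recursion on the first draw, so that
    its properties follow by induction on [n]. *)
Fixpoint avg n f : R :=
  if n is n'.+1 then #|T|%:R^-1 * \sum_k avg n' (fun t => f (k :: t))
  else f [::].

Let cardT_neq0 : #|T|%:R != 0 :> R.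
Proof. by rewrite pnatr_eq0 -lt0n. Qed.

Let mean_const (a : R) : #|T|%:R^-1 * \sum_(k : T) a = a.
Proof. by rewrite sumr_const -[a *+ _]mulr_natl mulKf. Qed.

Lemma avg_eq n f1 f2 : (forall t, size t = n -> f1 t = f2 t) ->
  avg n f1 = avg n f2.
Proof.
elim: n f1 f2 => [|n IH] f1 f2 f12 /=; first exact: f12.
congr (_ * _); apply: eq_bigr => k _; apply: IH => t tn.
by apply: f12; rewrite /= tn.
Qed.

Lemma avg_le n f1 f2 : (forall t, size t = n -> f1 t <= f2 t) ->
  avg n f1 <= avg n f2.
Proof.
elim: n f1 f2 => [|n IH] f1 f2 f12 /=; first exact: f12.
rewrite ler_wpM2l ?invr_ge0 //; apply: ler_sum => k _; apply: IH => t tn.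
by apply: f12; rewrite /= tn.
Qed.

Lemma avg_const n a : avg n (fun=> a) = a.
Proof.
elim: n => //= n IH; under eq_bigr do rewrite IH.
exact: mean_const.
Qed.

Lemma avgD n f1 f2 : avg n (fun t => f1 t + f2 t) = avg n f1 + avg n f2.
Proof.
elim: n f1 f2 => //= n IH f1 f2; under eq_bigr do rewrite IH.
by rewrite big_split mulrDr.
Qed.

Lemma avgZ n a f : avg n (fun t => a * f t) = a * avg n f.
Proof.
elim: n f => //= n IH f; under eq_bigr do rewrite IH.
by rewrite -mulr_sumr mulrCA.
Qed.

Lemma avg_sum n (I : Type) (r : seq I) (F : I -> seq T -> R) :
  avg n (fun t => \sum_(i <- r) F i t) = \sum_(i <- r) avg n (F i).
Proof.
elim: r => [|i r IH].
  by rewrite big_nil -[RHS](avg_const n); apply: avg_eq => t _; rewrite big_nil.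
rewrite big_cons -IH -avgD; apply: avg_eq => t _; exact: big_cons.
Qed.

Let deviation n k (t : seq T) : R := (count_mem k t)%:R - n%:R / #|T|%:R.

Let deviation_cons n k h t : deviation n.+1 k (h :: t) =
  deviation n k t + ((h == k)%:R - #|T|%:R^-1).
Proof. by rewrite /deviation /= natrD -natr1 mulrDl; ring. Qed.

Let mean_dev k : #|T|%:R^-1 * \sum_(h : T) ((h == k)%:R - #|T|%:R^-1) = 0 :> R.
Proof.
rewrite big_split mulrDr mean_const (bigD1 k) //= eqxx big1 => [|h /negPf-> //].
by rewrite addr0 mulr1 subrr.
Qed.

Let avg_deviation n k : avg n (deviation n k) = 0.
Proof.
elim: n => [|n IH] /=; first by rewrite /deviation mul0r subr0.
under eq_bigr => h _.
  rewrite (avg_eq (f2 := fun t => deviation n k t + ((h == k)%:R - #|T|%:R^-1))).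
    rewrite avgD IH add0r avg_const; over.
  by move=> t _; exact: deviation_cons.
exact: mean_dev.
Qed.

Lemma avg_count n k : avg n (fun t => (count_mem k t)%:R) = n%:R / #|T|%:R.
Proof.
apply/eqP; rewrite -subr_eq0 -(avg_const n (- (_ / _))) -avgD.
by apply/eqP; exact: avg_deviation n k.
Qed.

(** Each draw adds a centred term with square at most 1; the cross term vanishes because the earlier
    deviation has mean 0. *)
Let avg_variance n k : avg n (fun t => deviation n k t ^+ 2) <= n%:R.
Proof.
elim: n => [|n IH] /=; first by rewrite /deviation mul0r subr0 expr0n.
under eq_bigr => h _.
  rewrite (avg_eq (f2 := fun t => deviation n k t ^+ 2 +
     (2 * ((h == k)%:R - #|T|%:R^-1) * deviation n k t +
     ((h == k)%:R - #|T|%:R^-1) ^+ 2))).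
    rewrite !avgD avgZ avg_deviation mulr0 add0r avg_const; over.
  by move=> t _; rewrite deviation_cons; ring.
rewrite big_split /= mulrDr mean_const -natr1 lerD //.
rewrite -[leRHS]mean_const ler_wpM2l ?invr_ge0 //; apply: ler_sum => h _.
have i0 : 0 <= #|T|%:R^-1 :> R by rewrite invr_ge0.
have i1 : #|T|%:R^-1 <= 1 :> R by rewrite invf_le1 ?ler1n // ltr0n.
by case: (h == k) => /=; nra.
Qed.

(** First moment from second moment: average the pointwise bound [|d| <= d^2 / (2 a) + a / 2] with
    [a = sqrt n]. *)
Lemma avg_deviation_le n k :
  avg n (fun t => `|(count_mem k t)%:R - n%:R / #|T|%:R|) <= Num.sqrt n%:R.
Proof.
case: n => [|n]; first by rewrite /= mul0r subr0 normr0 sqrtr_ge0.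
set a := Num.sqrt _; have a0 : 0 < a by rewrite sqrtr_gt0.
have aa : a ^+ 2 = n.+1%:R by rewrite sqr_sqrtr.
apply: (@le_trans _ _ (avg n.+1 (fun t =>
    a^-1 / 2 * deviation n.+1 k t ^+ 2 + a / 2))).
  apply: avg_le => t _; rewrite -/(deviation n.+1 k t) -(ler_pM2l a0).
  set d := deviation _ _ _.
  have -> : a * (a^-1 / 2 * d ^+ 2 + a / 2) = (d ^+ 2 + a ^+ 2) / 2.
    by field; rewrite gt_eqF.
  (* AM-GM: [2 a |d| <= d^2 + a^2] *)
  rewrite -(real_normK (num_real d)).
  by have := sqr_ge0 (a - `|d|); nra.
rewrite avgD avgZ avg_const -(ler_pM2l a0).
have := avg_variance n.+1 k; set v := avg _ _; rewrite -aa => va.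
have -> : a * (a^-1 / 2 * v + a / 2) = (v + a ^+ 2) / 2.
  by field; rewrite gt_eqF.
by nra.
Qed.

(** Fractional packings are stable under convex combination: concatenate the packings of all first
    draws, each scaled by [1 / #|T|]. *)
Lemma avg_fractional n s (c : seq T -> T -> R) (v : seq T -> R) :
  (forall t, size t = n -> exists2 l, fractional s (c t) l & weight l = v t) ->
  exists2 l, fractional s (fun k => avg n (c ^~ k)) l & weight l = avg n v.
Proof.
elim: n c v => [|n IH] c v cv /=; first by exact: cv.
have {IH}/fin_all_exists2[l fl wl] : forall h : T, exists2 l,
    fractional s (fun k => avg n (fun t => c (h :: t) k)) l &
    weight l = avg n (fun t => v (h :: t)).
  by move=> h; apply: IH => t tn; apply: cv; rewrite /= tn.
pose scale := [seq [seq (#|T|%:R^-1 * z.1, z.2) | z <- l h] | h <- enum T].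
exists (flatten scale).
  apply: (fractional_le (c := fun k =>
    \sum_(h <- enum T) #|T|%:R^-1 * avg n (fun t => c (h :: t) k))).
    by move=> k; rewrite big_enum mulr_sumr.
  rewrite /scale; elim: (enum T) => [|h r IHr] /=.
    by apply: fractional_le (fractional_nil s) => k; rewrite big_nil.
  apply: fractional_le (fractional_cat (fractional_scale _ (fl h)) IHr).
    by move=> k; rewrite big_cons.
  by rewrite invr_ge0.
rewrite mulr_sumr -big_enum /= /scale.
elim: (enum T) => [|h r IHr] /=; first by rewrite /weight !big_nil.
by rewrite weight_cat weight_scale wl IHr big_cons.
Qed.

Lemma class_card_nth s (t : seq T) k0 k :
  class_card (fun i : 'I_(size (map s t)) => nth k0 t i) k = count_mem k t.
Proof.
rewrite /class_card -sum1_card -sum1_count (big_nth k0) big_mkord size_map.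
by apply: eq_bigl => i; rewrite !inE.
Qed.

(** On average a sample contains each position [n / #|T|] times, so the averaged optimal packings,
    scaled by [#|T| / n], respect unit capacities. *)
Lemma sampled_fractional n s : (0 < n)%N ->
  exists2 l, fractional s (fun=> 1) l &
    weight l = #|T|%:R * (avg n (fun t => (OPT (map s t))%:R) / n%:R).
Proof.
move=> n0; have /card_gt0P[k0 _] := T_gt0.
have [t _|l fl wl] := @avg_fractional n s
    (fun t k => (count_mem k t)%:R) (fun t => (OPT (map s t))%:R).
  have [i|l fl wl] := @OPT_weight _ (map s t) _ s (fun i => nth k0 t i).
    by rewrite (nth_map k0) //; have := ltn_ord i; rewrite {2}size_map.
  by exists l => //; apply: fractional_le fl => k; rewrite class_card_nth.
have nT : 0 <= #|T|%:R / n%:R :> R by rewrite divr_ge0.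
exists [seq (#|T|%:R / n%:R * z.1, z.2) | z <- l].
  apply: fractional_le (fractional_scale nT fl) => k.
  by rewrite avg_count mulrA divfK ?mulfV // pnatr_eq0 -lt0n.
by rewrite weight_scale wl mulrAC -mulrA.
Qed.

(** A sample contains every position at least [n / #|T| - dev t] times, so [l] scaled by this factor
    fits and can be rounded down. The mean of [dev] is at most [#|T| * sqrt n]. *)
Lemma weight_le_sampled n s l : (0 < n)%N -> fractional s (fun=> 1) l ->
  weight l / #|T|%:R - (weight l * #|T|%:R + (size l)%:R) / Num.sqrt n%:R <=
  avg n (fun t => (OPT (map s t))%:R) / n%:R.
Proof.
move=> n0 fl; have /card_gt0P[k0 _] := T_gt0.
have n0R : 0 < n%:R :> R by rewrite ltr0n.
have w0 := weight_ge0 fl.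
pose dev t : R := \sum_(k <- enum T) `|(count_mem k t)%:R - n%:R / #|T|%:R|.
have ptw t : size t = n ->
    weight l * (n%:R / #|T|%:R) - (size l)%:R + - weight l * dev t <=
      (OPT (map s t))%:R.
  (* With a negative factor the lower bound is at most 0, hence trivial. *)
  move=> _; have [d0|d0] := ltP (n%:R / #|T|%:R - dev t) 0.
    apply: le_trans (ler0n _ _).
    have : 0 <= (size l)%:R :> R by [].
    by have := mulr_ge0_le0 w0 (ltW d0); rewrite mulrBr; lra.
  have frac : fractional s
      (fun k => (class_card (fun i : 'I_(size (map s t)) => nth k0 t i) k)%:R)
      [seq ((n%:R / #|T|%:R - dev t) * z.1, z.2) | z <- l].
    apply: fractional_le (fractional_scale d0 fl) => k.
    rewrite mulr1 class_card_nth /dev (bigD1_seq k) ?mem_enum ?enum_uniq //=.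
    set rest := \sum_(_ <- _ | _) _.
    have : 0 <= rest by rewrite sumr_ge0.
    by have := ler_norm (n%:R / #|T|%:R - (count_mem k t)%:R  : R);
      rewrite distrC; lra.
  have := weight_le_OPT _ frac; rewrite weight_scale (size_map _ l) => h.
  suff : (n%:R / #|T|%:R - dev t) * weight l <=
      (OPT (map s t))%:R + (size l)%:R by lra.
  apply: h => i; rewrite (nth_map k0) //.
  by have := ltn_ord i; rewrite {2}size_map.
have := avg_le ptw; rewrite avgD avg_const avgZ avg_sum => le1.
have le2 : \sum_(k <- enum T) avg n (fun t => `|(count_mem k t)%:R - n%:R / #|T|%:R|)
    <= #|T|%:R * Num.sqrt n%:R.
  apply: le_trans (ler_sum _ (fun k _ => avg_deviation_le n k)) _.
  by rewrite big_enum sumr_const mulr_natl.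
set a := Num.sqrt n%:R in le2 *.
have a0 : 0 < a by rewrite sqrtr_gt0.
have aa : a ^+ 2 = n%:R by rewrite sqr_sqrtr // ltW.
(* This absorbs the rounding loss [size l / n] into [size l / sqrt n]. *)
have a1 : 1 <= a by rewrite -[1]sqrtr1 ler_sqrt // ler1n.
rewrite ler_pdivlMr //; apply: le_trans le1.
rewrite mulrBl [_ / a * _]mulrAC -[in X in _ - X]aa expr2 mulrA mulfK ?gt_eqF //.
have : 0 <= (size l)%:R :> R by [].
have := ler_wpM2l w0 le2.
rewrite mulrAC -!mulrA.
set z : R := (size l)%:R; set D := \sum_(_ <- _) _; nra.
Qed.

End Average.

(** * From i.i.d. sizes to uniform positions, and existence of the limit *)

Section Sampling.
Context {R : realType}.

Lemma sum_tupleS (J : finType) n (F : n.+1.-tuple J -> R) :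
  \sum_t F t = \sum_j \sum_(t : n.-tuple J) F [tuple of j :: t].
Proof.
rewrite pair_big /=.
rewrite (reindex (fun x : J * n.-tuple J => [tuple of x.1 :: x.2])) //=.
exists (fun t : n.+1.-tuple J => (thead t, [tuple of behead t])).
  by move=> [j t] _ /=; congr (_, _); apply: val_inj.
by move=> t _; rewrite [t in RHS]tuple_eta.
Qed.

(** The law [p] is the image under [idx] of the uniform law on [T]; group the first draw by the
    fibres of [idx]. *)
Lemma sum_iid_avg (T J : finType) (idx : T -> J) (p : J -> R) n
    (f : seq J -> R) :
  (forall j, p j = #|[set k | idx k == j]%SET|%:R / #|T|%:R) ->
  \sum_(t : n.-tuple J) (\prod_(i < n) p (tnth t i)) * f t =
  avg n (fun t : seq T => f (map idx t)).
Proof.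
move=> pE; elim: n f => [|n IH] f /=.
  rewrite (big_pred1 [tuple]) => [|t]; last by apply/esym/eqP; exact: tuple0.
  by rewrite big_ord0 mul1r.
rewrite sum_tupleS (partition_big idx xpredT) //= mulr_sumr.
apply: eq_bigr => j _.
rewrite [in RHS](eq_bigr (fun=>
  avg n (fun t : seq T => f (j :: map idx t)))); last first.
  by move=> k /eqP <-.
rewrite sumr_const -(IH (fun s => f (j :: s))) mulrnAr -mulrnAl.
rewrite (_ : _ *+ _ = p j); last first.
  by rewrite pE mulr_natl; congr (_ *+ _);
    apply: eq_card => k; rewrite finset.inE.
rewrite mulr_sumr; apply: eq_bigr => t _.
rewrite big_ord_recl tnth0 -mulrA; congr (_ * (_ * _)).
by apply: eq_bigr => i _; rewrite tnthS.
Qed.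

Section ValueIndex.
Variables (L S : seq R) (SL : {subset S <= L}).

Fact value_index_subproof (i : 'I_(size S)) :
  (index (S`_i)%R (undup L) < size (undup L))%N.
Proof. by rewrite index_mem mem_undup SL // mem_nth. Qed.

Definition value_index i := Ordinal (value_index_subproof i).

Lemma nth_value_index i : (undup L)`_(value_index i) = S`_i.
Proof. by rewrite /= nth_index // mem_undup SL // mem_nth. Qed.

Lemma class_card_value_index j :
  class_card value_index j = count_mem (undup L)`_j S.
Proof.
rewrite /class_card -sum1_card -sum1_count (big_nth 0) big_mkord.
apply: eq_bigl => i; rewrite finset.inE -nth_value_index.
by rewrite [pred1 _ _]nth_uniq ?undup_uniq ?ltn_ord.
Qed.

End ValueIndex.

(** With the distinct values as types, unpack one list and repack in the other: only multiplicities
    matter. *)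
Lemma perm_OPT (L1 L2 : seq R) : perm_eq L1 L2 -> OPT L1 = OPT L2.
Proof.
suff le_OPT (A B : seq R) : perm_eq A B -> (OPT A <= OPT B)%N.
  by move=> e; apply/eqP; rewrite eqn_leq !le_OPT // perm_sym.
move=> AB; have AA : {subset A <= A} by [].
have BA : {subset B <= A} by move=> x; rewrite (perm_mem AB).
pose s (j : 'I_(size (undup A))) := (undup A)`_j.
have [i|ps [<- ps1 psc]] := @OPT_unpack _ A _ s (value_index AA).
  by rewrite /s nth_value_index.
apply: (@OPT_pack _ B _ s (value_index BA)) => // [i|k].
  by rewrite /s nth_value_index.
by rewrite (leq_trans (psc k)) // !class_card_value_index (permP AB).
Qed.

Lemma inv_sqrt_small (C e : R) : 0 < e ->
  exists2 n0, (0 < n0)%N & forall n, (n0 <= n)%N -> C / Num.sqrt n%:R <= e.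
Proof.
move=> e0; exists (Num.truncn ((C / e) ^+ 2)).+1 => // n n0n.
have n0 : (0 < n%:R :> R) by rewrite ltr0n (leq_trans _ n0n).
rewrite ler_pdivrMr ?sqrtr_gt0 // mulrC -ler_pdivrMr //.
apply: le_trans (ler_norm _) _; rewrite -sqrtr_sqr ler_sqrt // ltW //.
apply: lt_le_trans (_ : (Num.truncn ((C / e) ^+ 2)).+1%:R <= _).
  by have /andP[] := truncn_itv (sqr_ge0 (C / e)).
by rewrite ler_nat.
Qed.

(** The limit is the supremum over positive indices, since each term bounds all others from below up
    to [C / sqrt n]. Index 0 is excluded because the averages are divided by [n]. *)
Lemma cvg_almost_superior (u : nat -> R) M :
  (forall n, (0 < n)%N -> u n <= M) ->
  (forall m, (0 < m)%N -> exists C, forall n, (0 < n)%N ->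
    u m - C / Num.sqrt n%:R <= u n) ->
  exists l, [/\ (u @ \oo --> l)%classic, l <= M &
    forall v C, (forall n, (0 < n)%N -> v - C / Num.sqrt n%:R <= u n) -> v <= l].
Proof.
move=> uM uC; pose U := [set u n | n in [set n | (0 < n)%N]]%classic.
have U0 : (U !=set0)%classic by exists (u 1%N), 1%N.
have UM : ubound U M by move=> _ [n n0 <-]; exact: uM.
have hU : has_sup U by split=> //; exists M.
have ul n : (0 < n)%N -> u n <= sup U.
  by move=> n0; apply: ub_le_sup; [exists M|exists n].
exists (sup U); split.
- apply/cvgrPdist_le => e e0.
  have e20 : 0 < e / 2 by rewrite divr_gt0.
  have [_ [m m0 <-] um] := sup_adherent e20 hU.
  have [C uCm] := uC m m0.
  have [n0 n00 Cn0] := inv_sqrt_small C e20.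
  exists n0 => // n /= n0n; have np : (0 < n)%N by exact: leq_trans n0n.
  have := ul n np; have := uCm n np; have := Cn0 n n0n => h1 h2 h3.
  by rewrite ger0_norm; lra.
- exact: ge_sup.
- move=> v C uv; apply/ler_addgt0Pr => e e0.
  have [n0 n00 Cn0] := inv_sqrt_small C e0.
  have := ul n0 n00; have := uv n0 n00; have := Cn0 n0 (leqnn _); lra.
Qed.

End Sampling.

Lemma expected_OPT_avg (R : realType) (L S : seq R) (L_neq0 : L != [::])
    (L01 : {in L, forall a : R, 0 <= a <= 1}) n : perm_eq S L ->
  expected_OPT (induced_distribution L_neq0 L01) n =
  avg n (fun t : seq 'I_(size S) => (OPT [seq S`_(nat_of_ord k) | k <- t])%:R).
Proof.
move=> SL; have sub : {subset S <= L} by move=> x; rewrite (perm_mem SL).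
rewrite /expected_OPT /iid_prob /=.
have pE (j : 'I_(size (undup L))) : ratr (induced_prob j) =
    #|[set k | value_index sub k == j]%SET|%:R / #|'I_(size S)|%:R :> R.
  rewrite /induced_prob -(permP SL) -(perm_size SL) card_ord.
  by rewrite fmorph_div !rmorph_nat -class_card_value_index.
rewrite (sum_iid_avg n
  (fun w => (OPT [seq induced_size j | j <- w])%:R) pE).
apply: avg_eq => t _; rewrite -map_comp; congr (OPT _)%:R.
by apply: eq_map => k; rewrite /= /induced_size nth_value_index.
Qed.

(** * Choice of the group size and the final estimate *)

Lemma exists_sqrtn N : exists g, (g ^ 2 <= N < g.+1 ^ 2)%N.
Proof.
have ex : exists g, (g ^ 2 <= N)%N by exists 0%N.
have ub g : (g ^ 2 <= N)%N -> (g <= N)%N.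
  by apply: leq_trans; case: g => // g; rewrite leq_pmulr.
case: (ex_maxnP ex ub) => g gN gmax; exists g; rewrite gN ltnNge.
by apply/negP => /gmax; rewrite ltnn.
Qed.

Theorem theorem1 (R : realType) :
  exists K : R, 0 < K /\
    forall (L : seq R) (L_neq0 : L != [::])
           (L01 : {in L, forall a : R, 0 <= a <= 1}),
      `| (OPT L)%:R - (size L)%:R * gamma (induced_distribution L_neq0 L01) |
        <= K * (size L)%:R `^ (2 / 3).
Proof.
exists 5; split => // L L_neq0 L01.
pose S := sort (fun x y : R => y <= x) L.
have SL : perm_eq S L by rewrite perm_sort.
have sizeS : size S = size L by exact: perm_size.
have N0 : (0 < size S)%N by rewrite sizeS lt0n size_eq0.
have S_ge0 i : 0 <= S`_i.
  have [iN|Ni] := ltnP i (size S); last by rewrite nth_default.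
  have : S`_i \in L by rewrite -(perm_mem SL) mem_nth.
  by case/L01/andP.
have S_dec i j : (i <= j)%N -> S`_j <= S`_i.
  move=> ij; have [jN|Nj] := ltnP j (size S);
    last by rewrite [leLHS]nth_default.
  have tr : transitive (fun x y : R => y <= x).
    by move=> y x z /[swap]; exact: le_trans.
  have rf : reflexive (fun x y : R => y <= x) by exact: lexx.
  apply: (sorted_leq_nth tr rf 0) => //; last by rewrite inE (leq_ltn_trans ij).
  by apply: sort_sorted => x y; exact: ge_total.
have [g /andP[gN Ng]] := exists_sqrtn (size S).
have g0 : (0 < g)%N.
  by rewrite lt0n; apply: contraTneq Ng => ->; rewrite -leqNgt.
pose s (i : 'I_(size S)) := S`_i.
pose u n : R := avg n (fun t : seq 'I_(size S) => (OPT (map s t))%:R) / n%:R.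
have T0 : (0 < #|'I_(size S)|)%N by rewrite card_ord.
have NR : 0 < (size S)%:R :> R by rewrite ltr0n.
(* [size S * u n] is the weight of a fractional packing of the positions, so grouping bounds all
   [u n] uniformly. *)
have uM n : (0 < n)%N -> u n <= (OPT S + g + (size S %/ g).+1)%:R / (size S)%:R.
  move=> n0; have [l fl wl] := sampled_fractional T0 s n0.
  have := weight_le_OPT_grouping S_dec g0 fl.
  by rewrite wl card_ord -/(u n) ler_pdivlMr // mulrC.
have lower l : fractional s (fun=> 1) l -> exists C, forall n, (0 < n)%N ->
    weight l / (size S)%:R - C / Num.sqrt n%:R <= u n.
  move=> fl; exists (weight l * (size S)%:R + (size l)%:R) => n n0.
  by have := weight_le_sampled T0 n0 fl; rewrite card_ord.
(* Each [u m] is such a weight divided by [size S], so [lower] makes it an almost lower bound for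
   the whole sequence. *)
have [gam [ugam gamM gamlower]] : exists l, [/\ (u @ \oo --> l)%classic,
    l <= (OPT S + g + (size S %/ g).+1)%:R / (size S)%:R &
    forall v C, (forall n, (0 < n)%N -> v - C / Num.sqrt n%:R <= u n) -> v <= l].
  apply: cvg_almost_superior => // m m0.
  have [l fl wl] := sampled_fractional T0 s m0.
  have [C uC] := lower l fl; exists C => n n0; have := uC n n0.
  by rewrite wl card_ord -/(u m) mulrC mulKf // gt_eqF.
have -> : gamma (induced_distribution L_neq0 L01) = gam.
  apply/cvg_lim => //; rewrite (_ : (fun n => _) = u) //.
  by apply/funext => n; rewrite (expected_OPT_avg _ _ _ SL).
(* An optimal packing is itself fractional, every position being its own type of capacity 1. *)
have OPTgam : (OPT S)%:R <= (size S)%:R * gam.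
  have [l fl wl] := @OPT_weight _ S _ s id (fun i => lexx _).
  have /lower[C] : fractional s (fun=> 1) l.
    apply: fractional_le fl => k; rewrite (_ : class_card _ _ = 1%N) //.
    by rewrite -(cards1 k); apply: eq_card => i; rewrite !finset.inE.
  by move=> /gamlower; rewrite wl ler_pdivrMr // mulrC.
have gam_le : (size S)%:R * gam <= (OPT S)%:R + (g + (size S %/ g).+1)%:R.
  by rewrite mulrC -ler_pdivlMr // -natrD addnA.
rewrite -(perm_OPT SL) -sizeS ler0_norm ?subr_le0 // opprB.
(* From [size S < (g + 1)^2] the quotient is at most [g + 2], so the sum is at most
   [2 g + 3 <= 5 g]; hence the constant 5. *)
have le5 : (g + (size S %/ g).+1 <= 5 * g)%N.
  have : (size S %/ g <= g + 2)%N.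
    by rewrite -ltnS ltn_divLR //; apply: leq_trans Ng _; rewrite -mulnn; nia.
  lia.
(* The error is of order [sqrt N]; the exponent 2/3 enters only here, by monotonicity of powers of
   [N >= 1]. *)
have gpow : g%:R <= (size S)%:R `^ (2 / 3) :> R.
  apply: (@le_trans _ _ ((size S)%:R `^ (2^-1))); last first.
    by rewrite ler_powR ?ler1n //; lra.
  rewrite powR12_sqrt // -[leLHS]ger0_norm // -sqrtr_sqr ler_sqrt //.
  by rewrite -natrX ler_nat.
rewrite -(ler_nat R) natrM in le5.
have := ler_wpM2l (ler0n R 5) gpow; lra.
Qed.
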